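(* Let $(L,* )$ be an LD-system. An oracle that solves the generalized $n$-modsimItLDP for $S_A$ and the $m$-simItLDP is sufficient to break key establishment Protocol 1.
   Context: An LD-system is a set $L$ with a binary operation $*$ such that $x*(y*z)=(x*y)*(x*z)$ for all $x,y,z\in L$. $\langle y_1,\ldots,y_k\rangle_*$ denotes the submagma of $(L,* )$ generated by $y_1,\ldots,y_k$. For $x=(x_1,\ldots,x_k)\in L^k$ put $\phi_x(y)=x_k*(x_{k-1}*\cdots*(x_2*(x_1*y))\cdots)$. Protocol 1: public elements $s_1,\ldots,s_m,t_1,\ldots,t_n\in L$ are given, with $S_A=\langle s_1,\ldots,s_m\rangle_*$, $S_B=\langle t_1,\ldots,t_n\rangle_*$. Alice's secret key is $(a_0,a)\in S_A\times L^{k_A}$ and Bob's secret key is $b\in S_B^{k_B}$ (for some secret $k_A,k_B\ge 1$). Put $\alpha=\phi_a$, $\beta=\phi_b$. Alice publishes $t_i'=\alpha(t_i)$ ($1\le i\le n$) and $p_0=\alpha(a_0)$; Bob publishes $s_j'=\beta(s_j)$ ($1\le j\le m$). The shared key is $K=\alpha(\beta(a_0))$. Breaking the protocol means finding $K$ from the public data $s_j,s_j',t_i,t_i',p_0$ (the attacker can evaluate $*$). $m$-simItLDP ($m$-simultaneous iterated LD-problem): given pairs $(s_1,s_1'),\ldots,(s_m,s_m')\in L^2$ for which there are unknown $k$ and $b\in L^k$ with $s_i'=\phi_b(s_i)$ for all $i\le m$, find $k'\in\mathbb{N}$ and $b'\in L^{k'}$ with $\phi_{b'}(s_i)=s_i'$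 for all $i\le m$. Generalized $n$-modsimItLDP for $S_A$ (modified $n$-simultaneous iterated LD-problem): given $p_0\in L$ and pairs $(t_1,t_1'),\ldots,(t_n,t_n')\in L^2$ for which there are unknown $k_A$, $a\in L^{k_A}$ and $a_0\in S_A$ with $t_i'=\phi_a(t_i)$ for all $i\le n$ and $p_0=\phi_a(a_0)$, find $k_A'\in\mathbb{N}$, $a'\in L^{k_A'}$ and $a_0'\in S_A$ such that $\phi_{a'}(a_0')=p_0$ and $\phi_{a'}(t_i)=t_i'$ for all $i\le n$. *)

(* Defs.v *)
From mathcomp Require Import all_boot.

Set Implicit Arguments.
Unset Strict Implicit.
Unset Printing Implicit Defensive.

Section LDProtocol.

Variables (L : Type) (op : L -> L -> L).

Definition LD_system : Prop :=
  forall x y z : L, op x (op y z) = op (op x y) (op x z).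

(* The submagma <y_1, ..., y_k>_* generated by y, as a predicate on L. *)
Inductive submagma (k : nat) (y : k.-tuple L) : L -> Prop :=
| submagma_gen (i : 'I_k) : submagma y (tnth y i)
| submagma_op (u v : L) :
    submagma y u -> submagma y v -> submagma y (op u v).

(* phi [:: x_1; ...; x_k] y = x_k * ( ... * (x_2 * (x_1 * y))); the empty
   sequence gives the identity. *)
Definition phi (x : seq L) (y : L) : L := foldl (fun u c => op c u) y x.

(* A problem instance is a tuple of pairs (s_i, s_i').  An oracle returns the
   tuple b' of L^k', with k' its own choice, as a sequence of size k'.  It has
   to be right only on the instances that have a (nonempty) solution, and may
   answer anything on the others. *)
Definition simItLDP_oracle (m : nat) : Type := m.-tuple (L * L) -> seq L.

Definition solves_simItLDP (m : nat) (O : simItLDP_oracle m) : Prop :=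
  forall q : m.-tuple (L * L),
    (exists (k : nat) (b : k.-tuple L),
       0 < k /\ forall i, (tnth q i).2 = phi b (tnth q i).1) ->
    forall i, phi (O q) (tnth q i).1 = (tnth q i).2.

(* Given p_0 and the pairs (t_i, t_i'), the oracle returns (a_0', a'). *)
Definition modsimItLDP_oracle (n : nat) : Type :=
  L -> n.-tuple (L * L) -> L * seq L.

Definition solves_modsimItLDP (n : nat) (S_A : L -> Prop)
    (O : modsimItLDP_oracle n) : Prop :=
  forall (p0 : L) (q : n.-tuple (L * L)),
    (exists (kA : nat) (a : kA.-tuple L) (a0 : L),
       [/\ 0 < kA, S_A a0,
           forall i, (tnth q i).2 = phi a (tnth q i).1 & p0 = phi a a0]) ->
    [/\ S_A (O p0 q).1,
        phi (O p0 q).2 (O p0 q).1 = p0 &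
        forall i, phi (O p0 q).2 (tnth q i).1 = (tnth q i).2].

End LDProtocol.

(* Black-box oracle algorithms.  Elements of L are held in a memory that only
   grows, and the algorithm refers to them by their addresses.  It can
   - halt, outputting the element at a given address;
   - append the product of the elements at two addresses;
   - send a simItLDP instance made of stored elements to the oracle, which
     appends the answer b';
   - send a modsimItLDP instance made of stored elements to the oracle, which
     appends a_0' followed by a'.
   After an oracle call it learns the length k' of the tuple returned.  This is
   the only information on L on which the control flow can depend: since an
   algorithm contains no element of L and no function on L, it cannot produce
   the key other than from the public data, * and the oracles.  (A mere
   function from the public data to L would not do: such functions need not be
   computable with * and the oracles.) *)
Inductive attacker (m n : nat) : Type :=
| Output (i : nat)
| Multiply (i j : nat) (next : attacker m n)
| AskSim (q : m.-tuple (nat * nat)) (next : nat -> attacker m n)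
| AskModsim (p : nat) (q : n.-tuple (nat * nat)) (next : nat -> attacker m n).

Section Execution.

Variables (L : Type) (op : L -> L -> L) (m n : nat).
Variables (Omod : modsimItLDP_oracle L n) (Osim : simItLDP_oracle L m).

(* Reading an unallocated address yields the element d. *)
Fixpoint run (d : L) (mem : seq L) (A : attacker m n) : L :=
  let read := nth d mem in
  let read2 (ij : nat * nat) := (read ij.1, read ij.2) in
  match A with
  | Output i => read i
  | Multiply i j next => run d (rcons mem (op (read i) (read j))) next
  | AskSim q next =>
      let b' := Osim (map_tuple read2 q) in
      run d (mem ++ b') (next (size b'))
  | AskModsim p q next =>
      let r := Omod (read p) (map_tuple read2 q) in
      run d (mem ++ r.1 :: r.2) (next (size r.2))
  end.

(* The memory initially holds s, s', t, t', p_0, in this order; d is p_0, so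
   that reading an unallocated address gives nothing beyond the public data. *)
Definition attack (A : attacker m n) (s s' : m.-tuple L) (t t' : n.-tuple L)
    (p0 : L) : L :=
  run p0 (s ++ s' ++ t ++ t' ++ [:: p0]) A.

(* With public elements s and t, whatever the secret keys (a_0, a) of Alice and
   b of Bob, A outputs K = alpha (beta a_0) given the public data. *)
Definition breaks_protocol (A : attacker m n) (s : m.-tuple L) (t : n.-tuple L)
    : Prop :=
  forall (kA kB : nat) (a0 : L) (a : kA.-tuple L) (b : kB.-tuple L),
    0 < kA -> 0 < kB ->
    submagma op s a0 ->
    (forall i, submagma op t (tnth b i)) ->
    let alpha := phi op a in
    let beta := phi op b in
    attack A s (map_tuple beta s) t (map_tuple alpha t) (alpha a0)
    = alpha (beta a0).

End Execution.

(* Main.v *)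
Require Import Defs.
From mathcomp Require Import all_boot.
From mathcomp Require Import zify.

(** In an LD-system every left translation, hence every [phi x], is an
    endomorphism.  Let [(a0', a')] and [b'] be the oracles' answers on the public
    data, and write [alpha'] and [beta'] for [phi a'] and [phi b'].
    Endomorphisms that agree on generators agree on the submagma generated, so
    [alpha'] agrees with [alpha] on [S_B], and [beta'] with [beta] on [S_A].
    As all entries of [b] lie in [S_B] and [alpha' a0' = p0 = alpha a0],
      [alpha' (beta' a0') = alpha' (phi b a0') = phi (alpha' b) p0
                          = phi (alpha b) (alpha a0) = alpha (phi b a0) = K].
    The attacker therefore outputs [alpha' (beta' a0')]. *)

Section LDTheory.

Variables (L : Type) (op : L -> L -> L).

Lemma phi_cat (x y : seq L) (z : L) : phi op (x ++ y) z = phi op y (phi op x z).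
Proof. exact: foldl_cat. Qed.

Lemma phi_op (HLD : LD_system op) (x : seq L) (u v : L) :
  phi op x (op u v) = op (phi op x u) (phi op x v).
Proof. by elim: x u v => //= c x IH u v; rewrite HLD IH. Qed.

Lemma phi_phi (HLD : LD_system op) (x y : seq L) (z : L) :
  phi op x (phi op y z) = phi op (map (phi op x) y) (phi op x z).
Proof. by elim: y z => //= c y IH z; rewrite IH (phi_op HLD). Qed.

Lemma eq_phi_submagma (HLD : LD_system op) (k : nat) (g : k.-tuple L)
    (x y : seq L) :
  (forall i, phi op x (tnth g i) = phi op y (tnth g i)) ->
  forall z, submagma op g z -> phi op x z = phi op y z.
Proof.
by move=> eq_g z; elim=> // u v _ IHu _ IHv; rewrite !(phi_op HLD) IHu IHv.
Qed.

Lemma eq_key (HLD : LD_system op) (m n : nat) (s : m.-tuple L)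
    (t : n.-tuple L) (a a' b b' : seq L) (a0 a0' : L) :
    (forall i, phi op a' (tnth t i) = phi op a (tnth t i)) ->
    (forall i, phi op b' (tnth s i) = phi op b (tnth s i)) ->
    (forall i : 'I_(size b), submagma op t (tnth (in_tuple b) i)) ->
    submagma op s a0' -> phi op a' a0' = phi op a a0 ->
  phi op a' (phi op b' a0') = phi op a (phi op b a0).
Proof.
move=> eq_t eq_s Sb Sa0' eq_p0.
(* [b'] is traded for [b] first: only the entries of [b] are known to lie in the submagma on which
   [a'] and [a] act alike. *)
rewrite (eq_phi_submagma HLD _ _ _ _ eq_s _ Sa0').
rewrite (phi_phi HLD a') (phi_phi HLD a) eq_p0; congr phi.
apply: (@eq_from_nth _ a0); rewrite !size_map // => i lt_i.
rewrite !(nth_map a0) //; apply: (eq_phi_submagma HLD _ _ _ _ eq_t).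
by have := Sb (Ordinal lt_i); rewrite (tnth_nth a0).
Qed.

End LDTheory.

Section Attack.

Variables m n : nat.

(* [sz] is the current size of the memory, i.e. the address of the next
   product. *)
Fixpoint compute_phi (xs : seq nat) (cur sz : nat) : attacker m n :=
  if xs is x :: xs' then Multiply x cur (compute_phi xs' sz sz.+1)
  else Output m n cur.

(** The public data end with [p_0] at address [p]. The answers then put [a_0'] at [p.+1], [a'] from
    [p.+2] on, and [b'] right after [a']. *)
Definition key_attacker : attacker m n :=
  let p := m + (m + (n + n)) in
  AskModsim p [tuple (m + (m + i), m + (m + (n + i))) | i < n] (fun ka =>
  AskSim [tuple (i : nat, m + i) | i < m] (fun kb =>
  compute_phi (iota (p.+2 + ka) kb ++ iota p.+2 ka) p.+1 (p.+2 + ka + kb))).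

Variables (L : Type) (op : L -> L -> L).
Variables (Omod : modsimItLDP_oracle L n) (Osim : simItLDP_oracle L m).

(** Appending a product leaves the entries at the addresses [xs] unchanged. *)
Lemma run_compute_phi (d : L) (mem : seq L) (xs : seq nat) (cur : nat) :
    all (fun i => i < size mem) xs -> cur < size mem ->
  run op Omod Osim d mem (compute_phi xs cur (size mem)) =
  phi op (map (nth d mem) xs) (nth d mem cur).
Proof.
elim: xs mem cur => //= x xs IH mem cur /andP[lt_x lt_xs] lt_cur.
set mem' := rcons _ _.
have sz' : size mem' = (size mem).+1 by rewrite size_rcons.
rewrite -sz' IH ?sz' //; last by apply: sub_all lt_xs => i /leqW.
rewrite nth_rcons ltnn eqxx; congr phi; apply/eq_in_map => i i_xs.
by rewrite nth_rcons (allP lt_xs).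
Qed.

Lemma attack_key_attacker (s s' : m.-tuple L) (t t' : n.-tuple L) (p0 : L) :
  let r := Omod p0 [tuple (tnth t i, tnth t' i) | i < n] in
  let b' := Osim [tuple (tnth s i, tnth s' i) | i < m] in
  attack op Omod Osim key_attacker s s' t t' p0 = phi op r.2 (phi op b' r.1).
Proof.
rewrite /attack /=; set p := m + (m + (n + n)).
set mem := s ++ _.
have szmem : size mem = p.+1 by rewrite !size_cat !size_tuple /= /p; lia.
(* The suffix [e] will be [a0' :: a'], already stored when the second oracle is called. *)
have nth_s (i : 'I_m) e : nth p0 (mem ++ e) i = tnth s i.
  by rewrite -catA nth_cat size_tuple ltn_ord -tnth_nth.
have nth_s' (i : 'I_m) e : nth p0 (mem ++ e) (m + i) = tnth s' i.
  rewrite -!catA nth_cat size_tuple ltnNge leq_addr addKn.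
  by rewrite nth_cat size_tuple ltn_ord -tnth_nth.
have nth_t (j : nat) : nth p0 mem (m + (m + j)) = nth p0 (t ++ t' ++ [:: p0]) j.
  by rewrite /mem; do 2!rewrite nth_cat size_tuple ltnNge leq_addr addKn.
have nth_t' (j : nat) :
    nth p0 mem (m + (m + (n + j))) = nth p0 (t' ++ [:: p0]) j.
  by rewrite nth_t nth_cat size_tuple ltnNge leq_addr addKn.
have -> : nth p0 mem p = p0.
  by rewrite nth_t' nth_cat size_tuple ltnn subnn.
clearbody mem.
set q := map_tuple _ _; set q1 := [tuple _ | i < n].
have -> : q = q1.
  apply: eq_from_tnth => i; rewrite tnth_map !tnth_mktuple /= nth_t nth_t'.
  by rewrite !nth_cat !size_tuple ltn_ord -!tnth_nth.
case: (Omod p0 q1) => a0' a' /=.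
set q' := map_tuple _ _; set q2 := [tuple _ | i < m].
have -> : q' = q2.
  by apply: eq_from_tnth => i; rewrite tnth_map !tnth_mktuple /= nth_s nth_s'.
set b' := Osim q2; set mem' := _ ++ b'.
have szmem' : size mem' = p.+2 + size a' + size b'.
  by rewrite !size_cat szmem /=; lia.
have mem'E : mem' = (mem ++ [:: a0']) ++ a' ++ b' by rewrite /mem' -!catA.
have szmem1 : size (mem ++ [:: a0']) = p.+2 by rewrite size_cat szmem addn1.
rewrite -szmem' run_compute_phi ?szmem'; last by lia.
  rewrite map_cat phi_cat !map_nth_iota ?szmem'; try lia.
  have -> : nth p0 mem' p.+1 = a0'.
    by rewrite /mem' -catA nth_cat szmem ltnn subnn.
  rewrite {1}mem'E -szmem1 drop_size_cat // take_size_cat //.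
  congr (phi op _ (phi op _ _)).
  by rewrite mem'E catA drop_size_cat ?size_cat // take_size.
by rewrite all_cat; apply/andP; split; apply/allP => i; rewrite mem_iota; lia.
Qed.

End Attack.

Theorem proposition3p6 (L : Type) (op : L -> L -> L) (HLD : LD_system op)
    (m n : nat) :
  exists A : attacker m n,
    forall (s : m.-tuple L) (t : n.-tuple L)
           (Omod : modsimItLDP_oracle L n) (Osim : simItLDP_oracle L m),
      solves_modsimItLDP op (submagma op s) Omod ->
      solves_simItLDP op Osim ->
      breaks_protocol op Omod Osim A s t.
Proof.
exists (key_attacker m n) => s t Omod Osim solve_mod solve_sim.
move=> kA kB a0 a b kA_gt0 kB_gt0 Sa0 Sb alpha beta.
rewrite attack_key_attacker; set q1 := [tuple _ | i < n].
set q2 := [tuple _ | i < m].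
(* Alice's secret key itself witnesses that the instance is solvable; Bob's does the same for [q2]
   below. *)
have [|Sa0' eq_p0 eq_t] := solve_mod (alpha a0) q1.
  by exists kA, a, a0; split=> // i; rewrite tnth_mktuple tnth_map.
have eq_s := solve_sim q2.
apply: (eq_key _ _ HLD _ _ s t) => // i.
- by have := eq_t i; rewrite tnth_mktuple tnth_map.
- have := eq_s _ i; rewrite tnth_mktuple tnth_map; apply.
  by exists kB, b; split=> // j; rewrite tnth_mktuple tnth_map.
- have lt_i : i < kB by rewrite -{2}(size_tuple b).
  by have := Sb (Ordinal lt_i); rewrite !(tnth_nth a0).
Qed.
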